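(* Let $n\ge1$, let $G$ be a finite abelian group of order $N$, written additively, let $g_0,\dots,g_{n-1}\in G$, and put $t=\sum_{j=0}^{n-1} g_j$. The character scheme over $(G,g)$ satisfies $\Phi(k)=[\,k=\mathbf 1\,]$ for all $k\in\mathbb{Z}_{\ge 0}^{\,n}$ with $|k|=n$ (and hence computes the permanent, i.e. $T[B]=\operatorname{per}B$ for every $B\in\mathbb{C}^{n\times n}$) if and only if $g_0,\dots,g_{n-1}$ have unique multiset sums in $G$, that is, the only $k\in\mathbb{Z}_{\ge0}^{\,n}$ with $|k|=n$ and $\sum_j k_jg_j=t$ is $k=\mathbf 1$.
   Context: Matrices $B=(b_{ij})\in\mathbb{C}^{n\times n}$ have rows indexed by $i=1,\dots,n$ and columns indexed by $j=0,\dots,n-1$. The permanent is $\operatorname{per} B=\sum_{\sigma}\prod_{i=1}^n b_{i\sigma(i)}$, the sum being over all bijections $\sigma:\{1,\dots,n\}\to\{0,\dots,n-1\}$. An evaluation scheme of order $n$ is a finite family of vectors $v_r\in\mathbb{C}^n$ ($r\in R$) with weights $w_r\in\mathbb{C}$ and a constant $c\in\mathbb{C}$. Its transform sum is $$T[B]=c\sum_{r\in R} w_r\prod_{i=1}^n\Bigl(\sum_{j=0}^{n-1} b_{ij}v_{r,j}\Bigr),\qquad B\in\mathbb{C}^{n\times n},$$ and for $k\in\mathbb{Z}_{\ge0}^{\,n}$ with $|k|:=\sum_j k_j=n$, $$\Phi(k)=c\sum_{r\in R} w_r\prod_{j=0}^{n-1} v_{r,j}^{\,k_j}\qquad(\text{with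 } t^0:=1).$$ Here $\mathbf 1=(1,\dots,1)$ and $[\,\cdot\,]$ is the Iverson bracket. The character scheme over $(G,g)$ is the evaluation scheme with index set $R=\hat G$ (the group of characters $\chi:G\to\mathbb{C}^\times$), vectors $v_{\chi,j}=\chi(g_j)$, weights $w_\chi=\overline{\chi(t)}$, and constant $c=1/N$. *)

(* Defs.v *)
From HB Require Import structures.
From mathcomp Require Import all_boot all_order all_fingroup all_algebra.
From mathcomp Require Import cyclic reals complex.

Set Implicit Arguments.
Unset Strict Implicit.
Unset Printing Implicit Defensive.

Import Order.TTheory GRing.Theory Num.Theory.
Local Open Scope ring_scope.

(* Rows 1..n and columns 0..n-1 of a matrix are both indexed by 'I_n, so that
   bijections from rows to columns become permutations of 'I_n. *)
Definition permanent (C : comNzRingType) (n : nat) (B : 'M[C]_n) : C :=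
  \sum_(s : 'S_n) \prod_(i < n) B i (s i).

Section Schemes.
Variables (C : comNzRingType) (n : nat).

Record scheme := Scheme {
  scheme_index : finType;
  scheme_vector : scheme_index -> 'rV[C]_n;
  scheme_weight : scheme_index -> C;
  scheme_const : C
}.

Definition transform_sum (S : scheme) (B : 'M[C]_n) : C :=
  scheme_const S *
  \sum_(r : scheme_index S)
    scheme_weight r * \prod_(i < n) \sum_(j < n) B i j * scheme_vector r 0 j.

Definition Phi (S : scheme) (k : {ffun 'I_n -> nat}) : C :=
  scheme_const S *
  \sum_(r : scheme_index S)
    scheme_weight r * \prod_(j < n) scheme_vector r 0 j ^+ k j.

End Schemes.

Section Characters.
Variables (C : numClosedFieldType) (G : finZmodType).

Definition is_character (chi : {ffun G -> C}) : bool :=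
  [forall x, chi x != 0] && [forall x, forall y, chi (x + y) == chi x * chi y].

Record character := Character {
  char_fun :> {ffun G -> C};
  _ : is_character char_fun
}.

HB.instance Definition _ := [isSub for char_fun].
HB.instance Definition _ := [Choice of character by <:].

Lemma char_neq0 (chi : character) x : chi x != 0.
Proof. by case: chi => f /= /andP[/forallP]. Qed.

Lemma charD (chi : character) x y : chi (x + y) = chi x * chi y.
Proof. by case: chi => f /= /andP[_ /forallP/(_ x)/forallP/(_ y)/eqP]. Qed.

Lemma char0 (chi : character) : chi 0 = 1.
Proof. by apply: (mulfI (char_neq0 chi 0)); rewrite -charD addr0 mulr1. Qed.

Lemma charMn (chi : character) x m : chi (x *+ m) = chi x ^+ m.
Proof. by elim: m => [|m IHm]; rewrite ?char0 // mulrS charD IHm exprS. Qed.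

(* The values of a character are roots of 'X^#|G| - 1, hence there are only
   finitely many characters. *)
Definition unity_roots : seq C :=
  sval (closed_field_poly_normal ('X^#|G| - 1 : {poly C})).

Lemma char_unity (chi : character) x : chi x \in unity_roots.
Proof.
rewrite /unity_roots; case: closed_field_poly_normal => r /= def_p.
have N_gt0 : (0 < #|G|)%N by apply/card_gt0P; exists 0.
rewrite -root_prod_XsubC -(rootZ _ _ (a := lead_coef ('X^#|G| - 1 : {poly C}))).
  rewrite -def_p rootE !hornerE -charMn.
  have /eqP : x *+ #|G| == 0.
    rewrite -FinRing.zmodXgE -cardsT.
    by rewrite (expg_cardG (G := [group of [set: G]])) ?inE.
  by move=> ->; rewrite char0 subrr.
by rewrite lead_coef_eq0 -size_poly_eq0 size_XnsubC.
Qed.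

Definition char_enc (chi : character) : {ffun G -> seq_sub unity_roots} :=
  [ffun x => SeqSub (char_unity chi x)].

Definition char_dec (h : {ffun G -> seq_sub unity_roots}) : option character :=
  insub [ffun x => ssval (h x)].

Lemma char_encK : pcancel char_enc char_dec.
Proof.
move=> chi; rewrite /char_dec; have -> : [ffun x => ssval (char_enc chi x)] = val chi.
  by apply/ffunP => x; rewrite !ffunE.
exact: valK.
Qed.

HB.instance Definition _ : isCountable character := PCanIsCountable char_encK.
HB.instance Definition _ : isFinite character := PCanIsFinite char_encK.

Variables (n : nat) (g : 'I_n -> G).

Definition target : G := \sum_(j < n) g j.

Definition character_scheme : scheme C n := {|
  scheme_index := character;
  scheme_vector := fun chi : character => \row_(j < n) chi (g j);
  scheme_weight := fun chi : character => (chi target)^*;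
  scheme_const := #|G|%:R^-1
|}.

End Characters.

Definition unique_multiset_sums (G : finZmodType) (n : nat) (g : 'I_n -> G) :=
  forall k : {ffun 'I_n -> nat},
    (\sum_(j < n) k j = n)%N -> \sum_(j < n) g j *+ k j = target g ->
    k = [ffun=> 1%N].

(* Main.v *)
Require Import Defs.
From mathcomp Require Import all_boot all_order all_fingroup all_algebra.
From mathcomp Require Import reals complex.
From mathcomp Require Import commutator cyclic separable algC cyclotomic classfun character.
Import Order.TTheory GRing.Theory Num.Theory.
Local Open Scope ring_scope.

(** Expanding the product of row sums gives
    [T[B] = \sum_f (\prod_i B i (f i)) * Phi (k_f)] over all maps [f] from rows
    to columns, where [k_f j] is the size of the fibre over [j]; the maps with
    [k_f = 1] are the permutations.  For the character scheme,
    [Phi k = N^-1 * \sum_chi chi (\sum_j k_j g_j - t)], which by orthogonality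
    is the indicator of [\sum_j k_j g_j = t].  Orthogonality only needs the
    characters to separate points: this is known for values in [algC], and the
    values of a character being powers of a primitive [N]-th root of unity, it
    transfers to any algebraically closed field of characteristic 0. *)

(** * Expansion of the transform sum over maps from rows to columns *)

Section Scheme.
Variables (C : comNzRingType) (n : nat).
Implicit Type f : {ffun 'I_n -> 'I_n}.

Definition fiber_card (f : {ffun 'I_n -> 'I_n}) : {ffun 'I_n -> nat} :=
  [ffun j => #|[pred i | f i == j]|].

Lemma sum_fiber_card f : (\sum_(j < n) fiber_card f j = n)%N.
Proof.
rewrite -[RHS]card_ord -sum1_card [RHS](partition_big f xpredT) //=.
by apply: eq_bigr => j _; rewrite ffunE -sum1_card; apply: eq_bigl.
Qed.

Lemma prod_fiber_card (v : 'I_n -> C) f :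
  \prod_(i < n) v (f i) = \prod_(j < n) v j ^+ fiber_card f j.
Proof.
rewrite (partition_big f xpredT) //=; apply: eq_bigr => j _.
rewrite ffunE -prodr_const; apply: eq_big => [i | i /eqP ->] //.
Qed.

(** Two points with the same image would share a fibre of size one. Conversely, an injective
    self-map of ['I_n] is bijective, so each fibre is the single preimage [h j]. *)
Lemma fiber_card_eq1 f : (fiber_card f == [ffun=> 1%N]) = injectiveb f.
Proof.
apply/eqP/injectiveP => [f1 i j fij | inj_f].
  have : (#|[pred l | f l == f j]| <= 1)%N.
    by have /ffunP/(_ (f j)) := f1; rewrite !ffunE => ->.
  by move/card_le1_eqP; apply; rewrite inE ?fij.
apply/ffunP => j; rewrite !ffunE.
have [h fh hf] : bijective f by apply: injF_bij.
by apply: (eq_card1 (x := h j)) => i; rewrite inE (can2_eq fh hf).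
Qed.

Lemma transform_sumE (S : scheme C n) (B : 'M[C]_n) :
  transform_sum S B =
  \sum_(f : {ffun 'I_n -> 'I_n}) (\prod_(i < n) B i (f i)) * Phi S (fiber_card f).
Proof.
rewrite /transform_sum.
under eq_bigr do rewrite bigA_distr_bigA mulr_sumr.
rewrite exchange_big mulr_sumr; apply: eq_bigr => f _ /=.
rewrite /Phi mulrCA; congr (_ * _); rewrite mulr_sumr; apply: eq_bigr => r _.
by rewrite big_split /= mulrCA (prod_fiber_card (fun j => scheme_vector r 0 j)).
Qed.

Lemma permanentE (B : 'M[C]_n) :
  permanent B =
  \sum_(f : {ffun 'I_n -> 'I_n} | injectiveb f) \prod_(i < n) B i (f i).
Proof.
rewrite /permanent (reindex (fun s : 'S_n => pval s)) /=; last first.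
  (* The default [1%g] is never reached, as only injective [f] have to be decoded. *)
  exists (fun f => insubd (1%g : 'S_n) f) => [s _ | f inj_f].
    exact: (valKd (1%g : 'S_n) s).
  exact: (insubdK (1%g : 'S_n) inj_f).
apply: eq_big => [s | s _]; first by rewrite (valP s).
by apply: eq_bigr => i _; rewrite pvalE.
Qed.

Lemma transform_sum_permanent (S : scheme C n) (B : 'M[C]_n) :
  (forall k : {ffun 'I_n -> nat}, (\sum_(j < n) k j = n)%N ->
     Phi S k = (k == [ffun=> 1%N])%:R) ->
  transform_sum S B = permanent B.
Proof.
move=> Phi1; rewrite transform_sumE permanentE [RHS]big_mkcond.
apply: eq_bigr => f _; rewrite Phi1 ?sum_fiber_card // fiber_card_eq1.
by case: injectiveb; rewrite (mulr1, mulr0).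
Qed.

End Scheme.

(** In characteristic 0, ['X^n - 1] is separable, so it has [n] distinct roots, and [n] distinct
    [n]-th roots of unity include a primitive one. *)
Lemma closed_prim_root_exists (C : numClosedFieldType) (n : nat) :
  (0 < n)%N -> exists z : C, n.-primitive_root z.
Proof.
move=> n_gt0; have [r] := closed_field_poly_normal ('X^n - 1 : {poly C}).
rewrite (monicP _) ?monicXnsubC // scale1r => Dp.
have rn1 : all n.-unity_root r by apply/allP=> z; rewrite -root_prod_XsubC -Dp.
have sz_r : (n < (size r).+1)%N by rewrite -(size_prod_XsubC r id) -Dp size_XnsubC.
have [|z] := hasP (has_prim_root n_gt0 rn1 _ sz_r); last by exists z.
by rewrite -separable_prod_XsubC -Dp separable_Xn_sub_1 // pnatr_eq0 -lt0n.
Qed.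

(** * Orthogonality of characters of a finite abelian group *)

Section Orthogonality.
Variables (C : numClosedFieldType) (G : finZmodType).
Implicit Types chi psi : Defs.character C G.

Lemma finZmod_mulrn_card (x : G) : x *+ #|G| = 0.
Proof.
rewrite -FinRing.zmodXgE -cardsT.
by rewrite (expg_cardG (G := [group of [set: G]])) ?inE.
Qed.

Lemma finZmod_card_gt0 : (0 < #|G|)%N.
Proof. by apply/card_gt0P; exists 0. Qed.

Lemma char_expr_card chi x : chi x ^+ #|G| = 1.
Proof. by rewrite -charMn finZmod_mulrn_card char0. Qed.

Lemma charN chi x : chi (- x) = (chi x)^-1.
Proof.
by apply: (mulfI (char_neq0 chi x)); rewrite -charD subrr char0 mulfV ?char_neq0.
Qed.

(** Roots of unity have norm 1, so conjugation inverts them. *)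
Lemma char_conj chi x : (chi x)^* = chi (- x).
Proof.
have /eqP nx1 : `|chi x| == 1.
  by rewrite -(pexpr_eq1 finZmod_card_gt0) // -normrX char_expr_card normr1.
by rewrite charN invC_norm nx1 expr1n invr1 mul1r.
Qed.

Lemma char_sum chi n (g : 'I_n -> G) (k : 'I_n -> nat) :
  chi (\sum_(j < n) g j *+ k j) = \prod_(j < n) chi (g j) ^+ k j.
Proof.
rewrite (big_morph _ (charD chi) (char0 chi)).
by apply: eq_bigr => j _; rewrite charMn.
Qed.

Lemma char_separates (x : G) : x != 0 -> exists chi, chi x != 1.
Proof.
move=> x_neq0; pose A := [set: G]%G; set N := #|G|.
have [i lin_i chi_ix] : exists2 i : Iirr A,
    'chi_i \is a linear_char & 'chi_i x != 1.
  (* The kernels of the linear characters meet in the derived subgroup, which is trivial since the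
     group is abelian. *)
  apply/exists_inP; apply: contraNT x_neq0 => /exists_inPn no_i.
  have : x \in (\bigcap_(i | 'chi[A]_i \is a linear_char) cfker 'chi_i)%g.
    apply/bigcapP => i lin_i; rewrite cfkerEirr inE lin_char1 //.
    exact: negbNE (no_i i lin_i).
  rewrite cap_cfker_lin_irr (derG1P (FinRing.zmod_abelian _)).
  by move/set1gP => ->.
have [z prim_z] := closed_prim_root_exists algC N finZmod_card_gt0.
have [w prim_w] := closed_prim_root_exists C N finZmod_card_gt0.
have chiN y : 'chi_i y ^+ N = 1.
  rewrite -lin_charX ?inE // FinRing.zmodXgE finZmod_mulrn_card.
  exact: lin_char1.
(* Discrete logarithm of ['chi_i y] to base [z]; changing the base to [w] moves the character into
   [C]. *)
pose e y := sval (prim_rootP prim_z (chiN y)).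
have chiE y : 'chi_i y = z ^+ e y by rewrite /e; case: prim_rootP.
have chiP : is_character [ffun y => w ^+ e y].
  apply/andP; split; apply/forallP => y.
    by rewrite ffunE expf_neq0 // (prim_root_eq0 prim_w) gtn_eqF ?finZmod_card_gt0.
  (* Equality of powers of [w], as of [z], is congruence of the exponents modulo [N]. *)
  apply/forallP => y'; rewrite !ffunE -exprD (eq_prim_root_expr prim_w).
  rewrite -(eq_prim_root_expr prim_z) exprD -!chiE -lin_charM ?inE // -chiE.
exists (Character chiP); rewrite /= ffunE.
by rewrite -(prim_order_dvd prim_w) (prim_order_dvd prim_z) -chiE.
Qed.

Lemma is_character_mul psi chi : is_character [ffun x => psi x * chi x].
Proof.
apply/andP; split; apply/forallP => x; first by rewrite ffunE mulf_neq0 ?char_neq0.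
by apply/forallP => y; rewrite !ffunE !charD mulrACA.
Qed.

Definition char_mul psi chi : Defs.character C G :=
  Character (is_character_mul psi chi).

Lemma char_mulE psi chi x : char_mul psi chi x = psi x * chi x.
Proof. by rewrite ffunE. Qed.

Lemma char_mul_inj psi : injective (char_mul psi).
Proof.
move=> chi chi' eq_chi; apply/val_inj/ffunP => x.
by apply: (mulfI (char_neq0 psi x)); rewrite -!char_mulE eq_chi.
Qed.

(** Multiplication by a [psi] with [psi x != 1] permutes the characters, so the sum is fixed under
    scaling by [psi x]. *)
Lemma sum_char_over_chars_neq0 (x : G) : x != 0 ->
  \sum_(chi : Defs.character C G) chi x = 0.
Proof.
case/char_separates => psi; rewrite -subr_eq0 => psix; apply: (mulfI psix).
rewrite mulr0 mulrBl mul1r; apply/eqP; rewrite subr_eq0 eq_sym; apply/eqP.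
rewrite mulr_sumr (reindex_inj (@char_mul_inj psi)).
by apply: eq_bigr => chi _; rewrite char_mulE.
Qed.

Lemma is_character1 : is_character [ffun _ : G => 1 : C].
Proof.
apply/andP; split; apply/forallP => x; first by rewrite ffunE oner_neq0.
by apply/forallP => y; rewrite !ffunE mulr1.
Qed.

(** The dual argument: for nontrivial [chi], translate [G] by some [y] with [chi y != 1]. *)
Lemma sum_char_over_group chi :
  \sum_(x : G) chi x = if chi == Character is_character1 then #|G|%:R else 0.
Proof.
have [-> | chi_neq1] := eqVneq.
  by rewrite -sum1_card natr_sum; apply: eq_bigr => x _; rewrite ffunE.
have [y] : exists y, chi y != 1.
  apply/existsP; apply: contraNT chi_neq1 => /existsPn chi1.
  apply/eqP/val_inj/ffunP => x; rewrite ffunE; exact/eqP/negbNE/chi1.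
rewrite -subr_eq0 => chiy; apply: (mulfI chiy).
rewrite mulr0 mulrBl mul1r; apply/eqP; rewrite subr_eq0 eq_sym; apply/eqP.
rewrite mulr_sumr (reindex_inj (addrI y)).
by apply: eq_bigr => x _; rewrite charD.
Qed.

(* At [x = 0] this counts the characters: add up the whole character table, once
   by rows and once by columns. *)
Lemma sum_char_over_chars (x : G) :
  \sum_(chi : Defs.character C G) chi x = if x == 0 then #|G|%:R else 0.
Proof.
case: eqP => [-> | /eqP]; last exact: sum_char_over_chars_neq0.
transitivity (\sum_(y : G) \sum_(chi : Defs.character C G) chi y).
  by rewrite [RHS](bigD1 0) //= [X in _ + X]big1 ?addr0 // => y;
     apply: sum_char_over_chars_neq0.
rewrite exchange_big /=; under eq_bigr do rewrite sum_char_over_group.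
by rewrite -big_mkcond big_pred1_eq.
Qed.

Lemma Phi_character_scheme n (g : 'I_n -> G) (k : {ffun 'I_n -> nat}) :
  Phi (character_scheme C g) k = (\sum_(j < n) g j *+ k j == target g)%:R.
Proof.
rewrite /Phi /=.
under eq_bigr => chi _.
  under eq_bigr do rewrite mxE.
  rewrite -char_sum char_conj -charD; over.
rewrite sum_char_over_chars addrC subr_eq0.
case: eqP => _; last by rewrite mulr0.
by rewrite mulVf // pnatr_eq0 -lt0n finZmod_card_gt0.
Qed.

End Orthogonality.

Theorem proposition3 (R : realType) (n : nat) (n_ge1 : (1 <= n)%N)
    (G : finZmodType) (g : 'I_n -> G) :
  ((forall k : {ffun 'I_n -> nat}, (\sum_(j < n) k j = n)%N ->
      Phi (character_scheme R[i] g) k = (k == [ffun=> 1%N])%:R)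
   <-> unique_multiset_sums g)
  /\
  ((forall k : {ffun 'I_n -> nat}, (\sum_(j < n) k j = n)%N ->
      Phi (character_scheme R[i] g) k = (k == [ffun=> 1%N])%:R)
   -> forall B : 'M[R[i]]_n,
        transform_sum (character_scheme R[i] g) B = permanent B).
Proof.
split; last by move=> Phi1 B; apply: transform_sum_permanent.
split=> [Phi1 k sum_k sum_g | uniq_g k sum_k].
  (* Here [Phi] equals 1, so [k] differing from the all-ones vector would give 1 = 0. *)
  apply/eqP; have := Phi1 k sum_k; rewrite Phi_character_scheme sum_g eqxx.
  by case: eqP => // _ /eqP; rewrite oner_eq0.
rewrite Phi_character_scheme; congr (_%:R); congr nat_of_bool.
apply/eqP/eqP => [/uniq_g -> // | ->].
by apply: eq_bigr => j _; rewrite ffunE.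
Qed.
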